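(* Let $n\ge1$ be an integer. The Chebyshev extrema $\eta_j=\cos(j\pi/n)$, $j=0,\ldots,n$, are the unique nodes in $[-1,1]$ for which $$ f[\eta_0,\ldots,\eta_n]\le 2^{n-1}\|f\|_\infty\quad\text{for all } f\in C[-1,1]. $$ That is, for distinct points $x_0<x_1<\cdots<x_n$ in $[-1,1]$, the inequality $f[x_0,\ldots,x_n]\le 2^{n-1}\|f\|_\infty$ holds for all $f\in C[-1,1]$ if and only if $\{x_0,\ldots,x_n\}=\{\cos(j\pi/n): j=0,\ldots,n\}$.
   Context: $C[-1,1]$ is the space of real-valued continuous functions on $[-1,1]$ and $\|f\|_\infty=\max_{x\in[-1,1]}|f(x)|$. For distinct nodes $x_0,\ldots,x_n\in[-1,1]$, the $n$th divided difference is defined recursively by $f[x_j]=f(x_j)$ and $$ f[x_0,\ldots,x_n]=\frac{f[x_0,\ldots,x_{n-1}]-f[x_1,\ldots,x_n]}{x_0-x_n}. $$ The divided difference does not depend on the order in which the nodes are listed; for $x_0<\cdots<x_n$ it equals $\sum_{j=0}^n(-1)^{j+n}\prod_{k\neq j}|x_k-x_j|^{-1}f(x_j)$. *)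

(* Defs.v *)
From mathcomp Require Import all_boot all_order all_algebra.
From mathcomp Require Import all_classical all_reals all_analysis.
Set Implicit Arguments.
Unset Strict Implicit.
Unset Printing Implicit Defensive.
Import Order.TTheory GRing.Theory Num.Theory.
Import numFieldNormedType.Exports.
Local Open Scope classical_set_scope.
Local Open Scope ring_scope.

(* An element of C[-1,1] is represented by any f : R -> R whose restriction to
   [-1,1] is continuous; the notions below only read its values on [-1,1]
   (for nodes in [-1,1]). *)
Definition continuous_itv11 (R : realType) (f : R -> R) : Prop :=
  {within `[(-1 : R), 1], continuous f}.

(* The supremum is a maximum when f is continuous on the compact [-1,1]. *)
Definition supnorm (R : realType) (f : R -> R) : R :=
  sup [set `|f t| | t in `[(-1 : R), 1]].

(* In the step case, [widen_ord (leqnSn _)] drops the last of the nodes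
   x_0, ..., x_m.+1 and [lift ord0] drops the first. *)
Fixpoint divdiff (R : realType) (f : R -> R) (n : nat) :
    ('I_n.+1 -> R) -> R :=
  match n with
  | 0%N => fun x => f (x ord0)
  | m.+1 => fun x =>
      (divdiff f (fun i : 'I_m.+1 => x (widen_ord (leqnSn m.+1) i))
       - divdiff f (fun i : 'I_m.+1 => x (lift ord0 i)))
      / (x ord0 - x ord_max)
  end.

Definition cheb_extrema (R : realType) (n : nat) (j : 'I_n.+1) : R :=
  cos (j%:R * pi / n%:R).

Definition divdiff_bound (R : realType) (n : nat) (x : 'I_n.+1 -> R) : Prop :=
  forall f : R -> R, continuous_itv11 f ->
    divdiff f x <= 2 ^+ n.-1 * supnorm f.

(* Main.v *)
(* For injective nodes, f[x_0,...,x_n] is the leading coefficient of the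
   interpolation polynomial, i.e. the sum of w_j f(x_j) with
   w_j = prod_(k <> j) (x_j - x_k)^-1, and the bound for all f amounts to
   sum |w_j| <= 2^(n-1).  The Chebyshev polynomial T_n has
   T_n[x_0,...,x_n] = 2^(n-1) for any nodes.  At the extrema T_n = +-1 with
   the sign of w_j, so sum |w_j| = 2^(n-1).  Conversely, the bound gives
   2^(n-1) = sum w_j T_n(x_j) <= sum |w_j| |T_n(x_j)| <= sum |w_j| <= 2^(n-1),
   which forces |T_n(x_j)| = 1 for all j, so every node is an extremum. *)
Require Import Defs.
From mathcomp Require Import all_boot all_order all_algebra.
From mathcomp Require Import all_classical all_reals all_analysis.
From mathcomp Require Import ring lra.
Set Implicit Arguments.
Unset Strict Implicit.
Unset Printing Implicit Defensive.
Import Order.TTheory GRing.Theory Num.Theory.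
Import numFieldNormedType.Exports.
Local Open Scope classical_set_scope.
Local Open Scope ring_scope.

(** * Divided differences and Lagrange interpolation *)

(** Induction on [n]. Subtracting p_(n+1) times the nodal polynomial of the kept nodes brings the
    degree down to at most [n] and keeps the values there, so each shorter divided difference is p_n
    + p_(n+1) times the sum of the kept nodes. *)
Lemma divdiff_coef (R : realType) (f : R -> R) (n : nat) (x : 'I_n.+1 -> R)
    (p : {poly R}) : injective x -> (size p <= n.+1)%N ->
  (forall i, p.[x i] = f (x i)) -> divdiff f x = p`_n.
Proof.
elim: n x p => [|n IH] x p x_inj size_p pf /=.
  by rewrite -pf (size1_polyC size_p) hornerC coefC.
pose q (y : 'I_n.+1 -> R) : {poly R} :=
  \prod_(i <- enum 'I_n.+1) ('X - (y i)%:P).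
have size_q y : size (q y) = n.+2.
  by rewrite size_prod_XsubC size_enum_ord.
have q_top y : (q y)`_n.+1 = 1.
  have := lead_coef_prod_XsubC (enum 'I_n.+1) xpredT y.
  by rewrite /lead_coef -/(q y) size_q.
have q_next y : (q y)`_n = - \sum_(i < n.+1) y i.
  have sz : size [seq y i | i <- enum 'I_n.+1] = n.+1.
    by rewrite size_map size_enum_ord.
  have := @coefPn_prod_XsubC R [seq y i | i <- enum 'I_n.+1].
  by rewrite sz => /(_ isT); rewrite big_map => ->; rewrite big_map big_enum.
have q_root y i : (q y).[y i] = 0.
  rewrite /q horner_prod (bigD1_seq i) ?mem_enum ?enum_uniq //=.
  by rewrite !hornerE subrr mul0r.
(* [h] stands for either of the two maps that drop an end node. *)
have step (h : 'I_n.+1 -> 'I_n.+2) : injective h ->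
    divdiff f (fun i => x (h i)) = p`_n + p`_n.+1 * \sum_i x (h i).
  move=> h_inj; rewrite (IH _ (p - p`_n.+1 *: q (fun i => x (h i)))).
  - by rewrite coefB coefZ q_next mulrN opprK.
  - by move=> i j /x_inj /h_inj.
  - apply/leq_sizeP => j; rewrite leq_eqVlt => /predU1P[<-|lt_nj].
      by rewrite coefB coefZ q_top mulr1 subrr.
    rewrite coefB coefZ (leq_sizeP _ _ size_p _ lt_nj).
    by rewrite (leq_sizeP (q _) n.+2 _ _ lt_nj) ?size_q // mulr0 subrr.
  - by move=> i; rewrite !hornerE q_root mulr0 subr0 pf.
rewrite !step; first last.
- by move=> i j /(congr1 val) /= ij; apply: val_inj.
- exact: lift_inj.
rewrite opprD addrACA subrr add0r -mulrBr.
have x0n : x ord0 - x ord_max != 0.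
  by rewrite subr_eq0; apply/eqP => /x_inj.
(* The interior nodes occur in both sums and cancel. *)
have -> : \sum_(i < n.+1) x (widen_ord (leqnSn n.+1) i)
    - \sum_(i < n.+1) x (lift ord0 i) = x ord0 - x ord_max.
  have := @big_ord_recl R 0 +%R n.+1 x; rewrite (big_ord_recr n.+1) /= => E.
  by apply/eqP; rewrite subr_eq addrAC -E addrK.
by rewrite mulfK.
Qed.

(** The barycentric weight w_j: for distinct nodes, the leading coefficient of the [j]-th Lagrange
    basis polynomial. *)
Definition nodal_weight (F : fieldType) (n : nat) (x : 'I_n.+1 -> F)
    (j : 'I_n.+1) : F := \prod_(k < n.+1 | k != j) (x j - x k)^-1.

Lemma lagrange_interpolation (F : fieldType) (n : nat) (x y : 'I_n.+1 -> F) :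
  injective x -> exists p : {poly F},
  [/\ (size p <= n.+1)%N, forall i, p.[x i] = y i
    & p`_n = \sum_j nodal_weight x j * y j].
Proof.
move=> x_inj.
pose l j : {poly F} := \prod_(k < n.+1 | k != j) ('X - (x k)%:P).
have size_l j : size (l j) = n.+1.
  rewrite /l -big_filter size_prod_XsubC -sum1_size big_filter sum1_card.
  by rewrite (cardC1 j) card_ord.
have l_top j : (l j)`_n = 1.
  have := lead_coef_prod_XsubC (index_enum 'I_n.+1) (fun k => k != j) x.
  by rewrite /lead_coef -/(l j) size_l.
exists (\sum_j (nodal_weight x j * y j) *: l j); split.
- apply: (leq_trans (size_sum _ _ _)); apply/bigmax_leqP => j _.
  by rewrite (leq_trans (size_scale_leq _ _)) ?size_l.
- move=> i; rewrite horner_sum (bigD1 i) //= big1 => [|j ji].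
    rewrite addr0 hornerZ /l horner_prod /nodal_weight mulrAC -big_split /=.
    rewrite big1 ?mul1r // => k ki; rewrite hornerXsubC mulVf // subr_eq0.
    by apply: contra ki => /eqP/x_inj ->.
  rewrite hornerZ /l horner_prod (bigD1 i) 1?eq_sym //=.
  by rewrite hornerXsubC subrr mul0r mulr0.
- by rewrite coef_sum; apply: eq_bigr => j _; rewrite coefZ l_top mulr1.
Qed.

Lemma divdiff_sum (R : realType) (f : R -> R) (n : nat) (x : 'I_n.+1 -> R) :
  injective x -> divdiff f x = \sum_j nodal_weight x j * f (x j).
Proof.
move=> x_inj; have [p [size_p pf <-]] := lagrange_interpolation (f \o x) x_inj.
exact: divdiff_coef.
Qed.

(** One polynomial interpolates [f] on the common node set, whatever the order of the nodes, and its
    coefficient of degree [n] is both sides. *)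
Lemma eq_range_divdiff (R : realType) (f : R -> R) (n : nat)
    (x y : 'I_n.+1 -> R) :
  injective x -> injective y -> range x = range y -> divdiff f x = divdiff f y.
Proof.
move=> x_inj y_inj xy.
have [p [size_p pf _]] := lagrange_interpolation (f \o x) x_inj.
rewrite (divdiff_coef x_inj size_p pf) (divdiff_coef y_inj size_p) // => i.
have [j _ <-] : range x (y i) by rewrite xy; exists i.
exact: pf.
Qed.

(** * The supremum norm on [-1,1] *)

Lemma ler_supnorm (R : realType) (f : R -> R) (t : R) :
  continuous_itv11 f -> -1 <= t <= 1 -> `|f t| <= supnorm f.
Proof.
move=> f_cont t11; have le11 : (-1 : R) <= 1 by lra.
have [a _ fa] := EVT_max le11 f_cont; have [b _ fb] := EVT_min le11 f_cont.
apply: ub_le_sup; last by exists t; rewrite //= in_itv.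
(* [sup] bounds its set only if the set is bounded; here all values lie between the minimum [f b]
   and the maximum [f a]. *)
exists (`|f a| + `|f b|) => _ [s s11 <-].
have := fa s s11; have := fb s s11.
have := ler_norm (f a); have := ler_norm (- f b); rewrite normrN.
have := normr_ge0 (f a); have := normr_ge0 (f b).
by rewrite ler_norml; lra.
Qed.

Lemma supnorm_le1 (R : realType) (f : R -> R) :
  (forall t, `|f t| <= 1) -> supnorm f <= 1.
Proof.
move=> f1; apply: ge_sup => [|_ [t _ <-] //].
by exists `|f 0|, 0 => //=; rewrite in_itv /=; apply/andP; split; lra.
Qed.

(** * Chebyshev polynomials of the first kind *)

Fixpoint chebyshev (R : nzRingType) (n : nat) : {poly R} :=
  match n with
  | 0%N => 1
  | k.+1 => match k with
            | 0%N => 'X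
            | m.+1 => 'X * chebyshev R k *+ 2 - chebyshev R m
            end
  end.

Lemma chebyshevSS (R : nzRingType) (n : nat) :
  chebyshev R n.+2 = 'X * chebyshev R n.+1 *+ 2 - chebyshev R n.
Proof. by []. Qed.

Lemma chebyshev_cos (R : realType) (n : nat) (t : R) :
  (chebyshev R n).[cos t] = cos (n%:R * t).
Proof.
(* The recurrence reaches back two indices, so the induction carries two consecutive cases. *)
suff: (chebyshev R n).[cos t] = cos (n%:R * t) /\
      (chebyshev R n.+1).[cos t] = cos (n.+1%:R * t) by case.
elim: n => [|n [IH0 IH1]]; first by rewrite mul0r cos0 mul1r !hornerE.
split=> //; rewrite chebyshevSS !hornerE IH0 IH1.
have -> : n.+2%:R * t = n.+1%:R * t + t by rewrite -[n.+2]addn1 natrD; ring.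
have -> : n%:R * t = n.+1%:R * t - t by rewrite -[n.+1]addn1 natrD; ring.
by rewrite cosB cosD; ring.
Qed.

Lemma size_chebyshev (R : nzRingType) (n : nat) :
  (size (chebyshev R n) <= n.+1)%N.
Proof.
suff: (size (chebyshev R n) <= n.+1)%N /\ (size (chebyshev R n.+1) <= n.+2)%N
  by case.
elim: n => [|n [IH0 IH1]]; first by rewrite size_poly1 size_polyX.
split=> //; apply/leq_sizeP => -[//|j] lt_nj.
rewrite chebyshevSS coefB coefMn coefXM /= (leq_sizeP _ _ IH1 _ lt_nj) mul0rn.
by rewrite (leq_sizeP _ _ IH0) ?subr0 // (leq_trans _ lt_nj) // ltnW.
Qed.

Lemma coef_chebyshev (R : nzRingType) (n : nat) :
  (chebyshev R n.+1)`_n.+1 = 2 ^+ n.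
Proof.
elim: n => [|n IH]; first by rewrite coefX.
rewrite chebyshevSS coefB coefMn coefXM /= IH exprS mulr_natl.
by rewrite (leq_sizeP _ _ (size_chebyshev R n)) ?subr0.
Qed.

(** * Chebyshev extrema and the two directions *)

Lemma cheb_extrema_itv (R : realType) (n : nat) (j : 'I_n.+1) :
  -1 <= @cheb_extrema R n j <= 1.
Proof. by rewrite cos_geN1 cos_le1. Qed.

Section ChebyshevExtrema.
Variables (R : realType) (n : nat).
Hypothesis n_gt0 : (0 < n)%N.

Let eta := @cheb_extrema R n.

Lemma cheb_extrema_angle (j : 'I_n.+1) : j%:R * pi / n%:R \in `[0, pi : R].
Proof.
have n0 : 0 < n%:R :> R by rewrite ltr0n.
rewrite in_itv /= divr_ge0 ?mulr_ge0 ?pi_ge0 //= ler_pdivrMr // mulrC.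
by rewrite ler_wpM2l ?pi_ge0 // ler_nat -ltnS.
Qed.

(** Cosine decreases strictly on [0, pi]. The extrema are thus listed from right to left, opposite
    to the increasing nodes of the theorem, which therefore compares ranges. *)
Lemma cheb_extrema_decr (i j : 'I_n.+1) : (i < j)%N -> eta j < eta i.
Proof.
move=> ij; rewrite /eta /cheb_extrema ltr_cos ?cheb_extrema_angle //.
by rewrite ltr_pM2r ?invr_gt0 ?ltr0n // ltr_pM2r ?pi_gt0 // ltr_nat.
Qed.

Lemma cheb_extrema_inj : injective eta.
Proof.
move=> i j eij; apply: val_inj.
by case: (ltngtP i j) => // /cheb_extrema_decr; rewrite eij ltxx.
Qed.

Lemma chebyshev_extrema (j : 'I_n.+1) : (chebyshev R n).[eta j] = (-1) ^+ j.
Proof.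
rewrite /eta /cheb_extrema chebyshev_cos mulrC divfK; last first.
  by rewrite pnatr_eq0 -lt0n.
elim: (j : nat) => [|k IH]; first by rewrite mul0r cos0.
by rewrite -natr1 mulrDl mul1r cosDpi IH exprS mulN1r.
Qed.

(** As the extrema decrease, exactly the [j] factors with k < j are negative. *)
Lemma nodal_weight_extrema (j : 'I_n.+1) :
  `|nodal_weight eta j| = nodal_weight eta j * (-1) ^+ j.
Proof.
(* The sign is spread over the factors, one -1 for each k < j, to compare the products factor by
   factor. *)
have -> : (-1) ^+ j = \prod_(k < n.+1 | k != j) (-1) ^+ (k < j)%N :> R.
  rewrite prodrXr; congr (_ ^+ _).
  transitivity (\sum_(k < n.+1 | (k < j)%N) 1)%N.
    by rewrite (big_ord_narrow (ltnW (ltn_ord j))) sum1_card card_ord.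
  rewrite big_mkcond [RHS]big_mkcond /=; apply: eq_bigr => k _.
  by case: eqVneq => [->|_]; rewrite ?ltnn //; case: ltnP.
rewrite /nodal_weight normr_prod -big_split /=; apply: eq_bigr => k kj.
have [lt_kj|le_jk] := ltnP k j.
  rewrite expr1 mulrN1 ltr0_norm // invr_lt0 subr_lt0.
  exact: cheb_extrema_decr.
rewrite expr0 mulr1 gtr0_norm // invr_gt0 subr_gt0.
by apply: cheb_extrema_decr; rewrite ltn_neqAle eq_sym kj.
Qed.

Lemma divdiff_chebyshev (x : 'I_n.+1 -> R) :
  injective x -> divdiff (horner (chebyshev R n)) x = 2 ^+ n.-1.
Proof.
move=> x_inj; rewrite (divdiff_coef x_inj (size_chebyshev R n)) //.
by case: n n_gt0 => // m _; exact: coef_chebyshev.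
Qed.

Lemma divdiff_bound_extrema : divdiff_bound eta.
Proof.
move=> f f_cont; have eta_inj := cheb_extrema_inj.
(* Writing 2^(n-1) as the divided difference of T_n turns both sides into sums that compare term by
   term. *)
rewrite -(divdiff_chebyshev eta_inj) !divdiff_sum // mulr_suml.
apply: ler_sum => j _; rewrite chebyshev_extrema -nodal_weight_extrema.
rewrite (le_trans (ler_norm _)) // normrM ler_wpM2l //.
by rewrite ler_supnorm ?cheb_extrema_itv.
Qed.

(* The test function sin (p t) has norm at most 1 and takes the values
   sgn (w_j) at the nodes when p interpolates the values sgn (w_j) * pi / 2. *)
Lemma sum_nodal_weight_le (x : 'I_n.+1 -> R) : injective x ->
  divdiff_bound x -> \sum_j `|nodal_weight x j| <= 2 ^+ n.-1.
Proof.
move=> x_inj x_bound.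
have [p [_ px _]] := lagrange_interpolation
  (fun j => Num.sg (nodal_weight x j) * (pi / 2)) x_inj.
pose f t := sin p.[t].
have f_cont : continuous_itv11 f.
  apply: continuous_subspaceT => t.
  apply: (@continuous_comp _ _ _ (horner p) sin); last exact: continuous_sin.
  exact: continuous_horner.
have f1 : supnorm f <= 1.
  by apply: supnorm_le1 => t; rewrite ler_norml sin_geN1 sin_le1.
have := x_bound f f_cont; rewrite divdiff_sum //.
rewrite (eq_bigr (fun j => `|nodal_weight x j|)).
  by move=> /le_trans; apply; rewrite ler_piMr ?exprn_ge0.
move=> j _; rewrite /f px.
case: sgrP => [w0|w0|w0].
- by rewrite w0 mul0r.
- by rewrite mul1r sin_pihalf mulr1.
- by rewrite mulN1r sinN sin_pihalf mulrN1.
Qed.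

(** With t = cos u, |cos (n u)| = 1 forces sin (n u) = 0, so n u is a multiple of pi. *)
Lemma chebyshev_norm_eq1 (t : R) : -1 <= t <= 1 ->
  `|(chebyshev R n).[t]| = 1 -> exists j, t = eta j.
Proof.
move=> t11; have tE : cos (acos t) = t by apply: acosK; rewrite in_itv.
rewrite -{1}tE chebyshev_cos => cos1.
have npos : 0 < n%:R :> R by rewrite ltr0n.
have pi0 := pi_gt0 R.
pose a := n%:R * acos t.
have a_ge0 : 0 <= a by rewrite mulr_ge0 ?acos_ge0.
have a_le : a <= n%:R * pi by rewrite ler_pM2l ?acos_lepi.
have sin_a : sin a = 0.
  apply/eqP; rewrite -sqrf_eq0 sin2cos2 -real_normK ?num_real //.
  by rewrite cos1 expr1n subrr.
have /andP[ka aks] := truncn_itv (divr_ge0 a_ge0 (ltW pi0)).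
set k := Num.truncn (a / pi) in ka aks.
move: ka aks; rewrite ler_pdivlMr // ltr_pdivrMr // => ka aks.
have sin_shift (m : nat) (b : R) : `|sin (b + m%:R * pi)| = `|sin b|.
  elim: m => [|m IH]; first by rewrite mul0r addr0.
  by rewrite -natr1 mulrDl mul1r addrA sinDpi normrN IH.
have aE : a = k%:R * pi.
  (* Otherwise a - k pi lies strictly between 0 and pi, where sine is positive, although its
     absolute value there is |sin a| = 0. *)
  apply/eqP; rewrite eq_le ka andbT leNgt; apply/negP => lt_ka.
  have : 0 < sin (a - k%:R * pi).
    by apply: sin_gt0_pi; move: aks; rewrite subr_gt0 lt_ka -natr1; lra.
  have := sin_shift k (a - k%:R * pi); rewrite subrK sin_a normr0.
  by move/esym/eqP; rewrite normr_eq0 => /eqP ->; rewrite ltxx.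
have k_le : (k < n.+1)%N by rewrite ltnS -(ler_nat R) -(ler_pM2r pi0) -aE.
exists (Ordinal k_le); rewrite -tE /eta /cheb_extrema /= -aE /a.
by rewrite mulrAC divff ?mul1r ?gt_eqF.
Qed.

Lemma divdiff_bound_range (x : 'I_n.+1 -> R) : injective x ->
  (forall i, -1 <= x i <= 1) -> divdiff_bound x -> range x = range eta.
Proof.
move=> x_inj x11 x_bound.
have T_le1 i : `|(chebyshev R n).[x i]| <= 1.
  have xE : cos (acos (x i)) = x i by apply: acosK; rewrite in_itv /= x11.
  by rewrite -xE chebyshev_cos ler_norml cos_geN1 cos_le1.
have w_gt0 i : 0 < `|nodal_weight x i|.
  rewrite normr_gt0; apply/prodf_neq0 => k ki; rewrite invr_eq0 subr_eq0.
  by apply: contra ki => /eqP/x_inj ->.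
have defect_ge0 (i : 'I_n.+1) : true ->
    0 <= `|nodal_weight x i| * (1 - `|(chebyshev R n).[x i]|).
  by move=> _; rewrite mulr_ge0 ?subr_ge0.
(* Equality throughout the chain for T_n; as each term is nonnegative and each weight nonzero, every
   |T_n(x_i)| is 1. *)
have defect0 : \sum_i `|nodal_weight x i| * (1 - `|(chebyshev R n).[x i]|) = 0.
  apply/eqP; rewrite eq_le sumr_ge0 // andbT.
  rewrite (eq_bigr _ (fun i _ => mulrBr _ _ _)) sumrB subr_le0.
  rewrite (eq_bigr _ (fun i _ => mulr1 _)).
  rewrite (le_trans (sum_nodal_weight_le x_inj x_bound)) //.
  rewrite -(divdiff_chebyshev x_inj) divdiff_sum //.
  by apply: ler_sum => i _; rewrite -normrM ler_norm.
have /choice[s xs] : forall i, exists j, x i = eta j.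
  move=> i; apply: chebyshev_norm_eq1 => //; apply/esym/eqP.
  have /eqP := psumr_eq0P defect_ge0 defect0 (i := i) isT.
  by rewrite mulf_eq0 gt_eqF //= subr_eq0.
(* An injective self-map of the finite index set is onto, so every extremum is a node. *)
have s_inj : injective s by move=> i j sij; apply: x_inj; rewrite !xs sij.
have [s' _ s's] := injF_bij s_inj.
apply/seteqP; split=> _ [i _ <-]; first by exists (s i); rewrite ?xs.
by exists (s' i); rewrite ?xs ?s's.
Qed.

End ChebyshevExtrema.

Theorem theorem3 (R : realType) (n : nat) (hn : (1 <= n)%N) :
  [/\ injective (@cheb_extrema R n),
      (forall j : 'I_n.+1, -1 <= cheb_extrema R j <= 1)
    & divdiff_bound (@cheb_extrema R n)]
  /\
  (forall x : 'I_n.+1 -> R,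
     (forall i j : 'I_n.+1, (i < j)%N -> x i < x j) ->
     (forall i : 'I_n.+1, -1 <= x i <= 1) ->
     (divdiff_bound x <-> range x = range (@cheb_extrema R n))).
Proof.
have eta_inj := @cheb_extrema_inj R n hn.
split.
  by split=> //; [exact: cheb_extrema_itv | exact: divdiff_bound_extrema].
move=> x x_incr x11.
have x_inj : injective x.
  move=> i j xij; apply: val_inj.
  by case: (ltngtP i j) => // /x_incr; rewrite xij ltxx.
split=> [|xE f f_cont]; first exact: divdiff_bound_range.
by rewrite (eq_range_divdiff f x_inj eta_inj xE); exact: divdiff_bound_extrema.
Qed.
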